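(* $\preccurlyeq_\omega \leq_B \preccurlyeq_{M_2}^2$. Consequently $\preccurlyeq_{M_2}^2$ is a universal countable Borel quasi-order.
   Context: For a countable monoid $M$ and standard Borel space $X$, $M$ acts on $X^M$ by $(m\cdot f)(s)=f(sm)$, and $f\preccurlyeq_M^X g$ iff $\exists m\in M\ f=m\cdot g$. $M_\omega$ is the free monoid on countably many generators, $M_2$ the free monoid on two generators, $\preccurlyeq_\omega=\preccurlyeq_{M_\omega}^{2^{\mathbb{N}}}$, and $\preccurlyeq_{M_2}^2$ is the quasi-order on $2^{M_2}$ with $X=2=\{0,1\}$. $Q\leq_B Q'$ means there is a Borel $f$ with $x\mathbin{Q}y\Leftrightarrow f(x)\mathbin{Q'}f(y)$. A countable Borel quasi-order is a Borel quasi-order on a standard Borel space with countable predecessor sets; it is universal if every countable Borel quasi-order Borel reduces to it. *)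

(* Defs.v *)
From HB Require Import structures.
From mathcomp Require Import all_boot all_order all_algebra.
From mathcomp Require Import monoid.
From mathcomp Require Import all_classical all_reals all_analysis.

Set Implicit Arguments.
Unset Strict Implicit.
Unset Printing Implicit Defensive.

Local Open Scope classical_set_scope.

(* The free monoid on T: words over T under concatenation. *)
Definition free_monoid (T : Type) : Type := seq T.

HB.instance Definition _ (T : choiceType) := Choice.on (free_monoid T).
HB.instance Definition _ (T : countType) := Countable.on (free_monoid T).
HB.instance Definition _ (T : choiceType) :=
  isMonoid.Build (free_monoid T) (@catA T) (@cat0s T) (@cats0 T).

(* Completeness is phrased with filters, as in the library's completeType,
   which has no common refinement with metricType. *)
Definition polish (R : realType) (P : metricType R) : Prop :=
  (forall F : set_system P, ProperFilter F -> cauchy F ->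
     exists l : P, F --> l) /\
  (exists2 D : set P, countable D & dense D).

(* Isomorphic, as a measurable space, to a Polish space with its Borel
   sets.  A measurableType is pointed, so the empty space (from which every
   reduction is trivial) is left out. *)
Definition standard_borel (R : realType) (d : measure_display)
    (X : measurableType d) : Prop :=
  exists (P : metricType R) (h : X -> P),
    [/\ polish P, bijective h &
        forall B : set P, <<s open >> B <-> measurable (h @^-1` B)].

Definition cylinders (I : Type) (d : measure_display) (X : measurableType d) :
    set (set (I -> X)) :=
  [set C | exists (i : I) (A : set X),
     measurable A /\ C = [set f : I -> X | A (f i)]].

(* X^I with the product sigma-algebra. *)
Definition power (I : Type) (d : measure_display) (X : measurableType d) :=
  g_sigma_algebraType (@cylinders I d X).

Definition mshift (M : monoidType) (X : Type) (m : M) (f : M -> X) : M -> X :=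
  fun s => f (s * m)%g.

Definition mshift_le (M : monoidType) (X : Type) (f g : M -> X) : Prop :=
  exists m : M, f = mshift m g.

Definition borel_reducible (d d' : measure_display) (X : measurableType d)
    (Y : measurableType d') (Q : X -> X -> Prop) (Q' : Y -> Y -> Prop) : Prop :=
  exists2 f : X -> Y, measurable_fun [set: X] f &
    forall x y, Q x y <-> Q' (f x) (f y).

Definition countable_borel_quasi_order (R : realType) (d : measure_display)
    (X : measurableType d) (Q : X -> X -> Prop) : Prop :=
  [/\ standard_borel R X,
      (forall x, Q x x),
      (forall x y z, Q x y -> Q y z -> Q x z),
      measurable [set p : X * X | Q p.1 p.2] &
      forall x, countable [set y | Q y x]].

Definition universal_countable_borel_quasi_order (R : realType)
    (d : measure_display) (X : measurableType d) (Q : X -> X -> Prop) : Prop :=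
  countable_borel_quasi_order R Q /\
  forall (d' : measure_display) (Y : measurableType d') (Q' : Y -> Y -> Prop),
    countable_borel_quasi_order R Q' -> borel_reducible Q' Q.

Definition M_omega : monoidType := free_monoid nat.
Definition M_two : monoidType := free_monoid bool.

Definition cantor_borel : measurableType _ := power nat bool.

Definition preceq_omega (f g : power M_omega cantor_borel) : Prop := mshift_le f g.

Definition preceq_M2_2 (f g : power M_two bool) : Prop := mshift_le f g.

(* Main.v *)
(* For the reduction, the generator n of M_omega is coded by the word 1 0^(n+1).
   These words form a suffix code, so each word of M_two is uniquely r c with c a
   code word of maximal length; on r c the image of F records the marker bit (r
   empty), the bits of F at the element coded by c (r = 1^(k+1)), or 0.  The
   residual parts r are arranged so that no shift by a nonempty r can turn an
   image into an image.

   For universality, a countable Borel quasi-order Q on X is generated by countably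
   many Borel maps f_n : X -> X, by the Lusin-Novikov theorem; if phi : X -> 2^N
   is Borel and injective, then x |-> (w |-> phi (f_w x)) reduces Q to
   preceq_omega.

   Lusin-Novikov is proved in the style of Miller's dichotomy arguments.  Let P be
   the image of a closed set K of the Baire space under w |-> (u w, v w).  An
   approximation is a finite list of finite words; its configurations are the lists
   of points of K extending these words and having the same image under u.  It is
   bad if the points of P given by its configurations can be avoided by removing
   countably many Borel graphs.  There are countably many approximations, so a
   single countable union N of Borel graphs deals with all bad ones.  If a
   configuration survives off N, then by Lusin's separation theorem each of its
   leaves can be split into two with different values of v over the same value
   of u: otherwise the possible values would lie in one more Borel graph.
   Iterating gives a Cantor scheme inside a single section of P, and a branch
   that diagonalizes against an enumeration of that section. *)
From HB Require Import structures.
Require Import Defs.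
From mathcomp Require Import all_boot all_order all_algebra.
From mathcomp Require Import all_classical all_reals all_analysis.

Set Implicit Arguments.
Unset Strict Implicit.
Unset Printing Implicit Defensive.

Import Order.TTheory GRing.Theory Num.Theory.
Local Open Scope classical_set_scope.

(** * The reduction of preceq_omega *)

Lemma mshift1 (M : monoidType) (X : Type) (f : M -> X) : mshift 1%g f = f.
Proof. by apply/funext => s; rewrite /mshift mulg1. Qed.

Lemma mshiftM (M : monoidType) (X : Type) (m n : M) (f : M -> X) :
  mshift m (mshift n f) = mshift (m * n)%g f.
Proof. by apply/funext => s; rewrite /mshift mulgA. Qed.

Lemma mshift_le_refl (M : monoidType) (X : Type) (f : M -> X) : mshift_le f f.
Proof. by exists 1%g; rewrite mshift1. Qed.

Lemma mshift_le_trans (M : monoidType) (X : Type) (f g h : M -> X) :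
  mshift_le f g -> mshift_le g h -> mshift_le f h.
Proof. by move=> [m ->] [n ->]; exists (m * n)%g; rewrite mshiftM. Qed.

Lemma measurable_fun_power (I : Type) d (X : measurableType d) d'
    (Y : measurableType d') (f : Y -> power I X) :
  (forall i, measurable_fun [set: Y] (fun y => f y i)) ->
  measurable_fun [set: Y] f.
Proof.
move=> mf; apply: measurability => //.
move=> _ [_ [i [A [mA ->]]] <-].
exact: mf.
Qed.

Lemma measurable_power_proj (I : Type) d (X : measurableType d) (i : I) :
  measurable_fun [set: power I X] (fun f : power I X => f i).
Proof.
move=> _ A mA; rewrite setTI; apply: sub_sigma_algebra.
by exists i, A.
Qed.

Lemma borel_reducible_trans d1 d2 d3 (X : measurableType d1)
    (Y : measurableType d2) (Z : measurableType d3)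
    (Q1 : X -> X -> Prop) (Q2 : Y -> Y -> Prop) (Q3 : Z -> Z -> Prop) :
  borel_reducible Q1 Q2 -> borel_reducible Q2 Q3 -> borel_reducible Q1 Q3.
Proof.
move=> [f mf fP] [g mg gP]; exists (g \o f); first exact: measurableT_comp.
by move=> x y; rewrite fP gP.
Qed.

(* Reads a word of M_two from right to left.  The suffix code 1 0^(n+1) stands
   for the generator n, and c.-1 is the exponent of the block being read (c = 0
   between blocks).  The residual words: the empty one carries the marker [true],
   1^(k+1) carries the k-th bit, all others carry [false]. *)
Fixpoint decode (c : nat) (F : M_omega -> nat -> bool) (w : seq bool) : bool :=
  match w with
  | [::] => c == 0
  | true :: w' => if c is n.+1 then decode 0 (mshift ([:: n] : M_omega) F) w'
                  else all id w' && F 1%g (size w')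
  | false :: w' => decode c.+1 F w'
  end.

Definition encode (F : M_omega -> nat -> bool) : M_two -> bool :=
  fun s => decode 0 F (rev s).

Lemma decode_block F c n w :
  decode c F (nseq n false ++ true :: w) =
  if c + n is k.+1 then decode 0 (mshift ([:: k] : M_omega) F) w
  else all id w && F 1%g (size w).
Proof.
elim: n c => [|n IH] c /=; first by rewrite addn0.
by rewrite IH addSnnS.
Qed.

(** The code of [m] written backwards, in the order in which [decode] reads it. *)
Definition code (m : M_omega) : seq bool :=
  flatten [seq nseq n.+1 false ++ [:: true] | n <- rev m].

Lemma decode_code m F w :
  decode 0 F (code m ++ w) = decode 0 (mshift m F) w.
Proof.
elim/last_ind: m F => [|m n IH] F.
  by have -> : mshift ([::] : M_omega) F = F by exact: mshift1.
rewrite /code rev_rcons /= -/(code m) -!catA decode_block /= IH mshiftM.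
by rewrite -cats1.
Qed.

Lemma encode_mshift m F : encode (mshift m F) = mshift (rev (code m) : M_two) (encode F).
Proof.
apply/funext => s; rewrite /encode /mshift.
by rewrite -[(s * _)%g]/(s ++ rev (code m)) rev_cat revK decode_code.
Qed.

(** The word [code m ++ nseq k.+1 true] reads off the bit [F m k]. *)
Lemma decode_inj F G : decode 0 F =1 decode 0 G -> F = G.
Proof.
move=> FG; apply/funext => m; apply/funext => k.
have := FG (code m ++ nseq k.+1 true).
rewrite !decode_code /= size_nseq /mshift !mul1g.
by have -> : all id (nseq k true) by rewrite all_nseq orbT.
Qed.

(** After [v] the reader is between two blocks, inside a block, or in a residual word entered by a
    letter 1. The last state is absorbing, and any further 0 makes the value [false]. *)
Lemma decode_cat c F v :
  [\/ exists m, forall t, decode c F (v ++ t) = decode 0 (mshift m F) t,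
      exists j m, forall t, decode c F (v ++ t) = decode j.+1 (mshift m F) t |
      exists r (z : nat -> bool),
        forall t, decode c F (v ++ t) = all id (r ++ t) && z (size (r ++ t))].
Proof.
elim: v c F => [|[] v IH] c F.
- case: c => [|j]; first by constructor 1; exists 1%g => t; rewrite mshift1.
  by constructor 2; exists j, 1%g => t; rewrite mshift1.
- case: c => [|n]; first by constructor 3; exists v, (F 1%g).
  case: (IH 0 (mshift ([:: n] : M_omega) F)) => /=.
  + by move=> [m E]; constructor 1; exists (m * [:: n])%g => t; rewrite E mshiftM.
  + move=> [j [m E]]; constructor 2; exists j, (m * [:: n])%g => t.
    by rewrite E mshiftM.
  + by move=> E; constructor 3.
- exact: (IH c.+1 F).
Qed.

Lemma encode_mshift_le F G : mshift_le (encode F) (encode G) -> mshift_le F G.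
Proof.
move=> [w FG].
have {}FG t : decode 0 F t = decode 0 G (rev w ++ t).
  have := congr1 (@^~ (rev t)) FG; rewrite /encode /mshift revK => ->.
  by rewrite -[(_ * _)%g]/(rev t ++ w) rev_cat revK.
case: (decode_cat 0 G (rev w)) => [[m E]|[j [m E]]|[r [z E]]].
- by exists m; apply: decode_inj => t; rewrite FG E.
(* For [F] the empty word carries the marker, but an unfinished block reads [false]. *)
- by have := FG [::]; rewrite E.
(* The word 0 1, read in this order, is the block of the generator 0, so [F] shows the marker there;
   in a residual state its letter 0 forces [false]. *)
- by have := FG [:: false; true]; rewrite E /= all_cat /= andbF.
Qed.

(** The word alone decides which coordinate of [F] is consulted, if any; this makes [encode]
    Borel. *)
Lemma decode_coordinate c w :
  (exists b, forall F, decode c F w = b) \/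
  (exists m k, forall F, decode c F w = F m k).
Proof.
elim: w c => [|[] w IH] c /=; first by left; exists (c == 0).
- case: c => [|n].
    case: (all id w); first by right; exists 1%g, (size w).
    by left; exists false.
  case: (IH 0) => [[b E]|[m [k E]]]; first by left; exists b => F; rewrite E.
  by right; exists (m * [:: n])%g, k => F; rewrite E.
- exact: IH.
Qed.

Lemma preceq_omega_reducible : borel_reducible preceq_omega preceq_M2_2.
Proof.
exists (encode : power M_omega cantor_borel -> power M_two bool); last first.
  move=> F G; split => [[m ->]|]; last exact: encode_mshift_le.
  by exists (rev (code m)); rewrite encode_mshift.
apply: measurable_fun_power => s; rewrite /encode.
have [[b E]|[m [k E]]] := decode_coordinate 0 (rev s).
  have mb : measurable_fun [set: power M_omega cantor_borel] (cst b).
    exact: measurable_cst.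
  by apply: eq_measurable_fun mb => F _ /=; rewrite E.
have mFmk : measurable_fun [set: power M_omega cantor_borel]
    (fun F : power M_omega cantor_borel => F m k).
  exact: (measurableT_comp (@measurable_power_proj nat _ bool k)
                           (@measurable_power_proj _ _ cantor_borel m)).
by apply: eq_measurable_fun mFmk => F _ /=; rewrite E.
Qed.

(** * Analytic sets of sequences *)

Definition agree (S : Type) (n : nat) (x y : nat -> S) : Prop :=
  forall i, i < n -> x i = y i.

Definition seq_closed (S : Type) (K : set (nat -> S)) : Prop :=
  forall x, (forall n, exists2 y, K y & agree n x y) -> K x.

Definition seq_continuous (S S' : Type) (f : (nat -> S) -> (nat -> S')) : Prop :=
  forall x n, exists m, forall y, agree m x y -> agree n (f x) (f y).

(** Taking closed subsets of the Baire space as sources includes the empty set. *)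
Definition analytic (S : Type) (A : set (nat -> S)) : Prop :=
  exists (K : set (nat -> nat)) (phi : (nat -> nat) -> (nat -> S)),
    [/\ seq_closed K, seq_continuous phi & A = phi @` K].

Lemma agreeW (S : Type) m n (x y : nat -> S) :
  m <= n -> agree n x y -> agree m x y.
Proof. by move=> mn xy i im; apply: xy; exact: leq_trans mn. Qed.

Lemma agree_sym (S : Type) n (x y : nat -> S) : agree n x y -> agree n y x.
Proof. by move=> xy i i_n; rewrite xy. Qed.

Lemma seq_continuous_coord (S S' : Type) (f : (nat -> S) -> (nat -> S')) :
  (forall x i, exists m, forall y, agree m x y -> f x i = f y i) ->
  seq_continuous f.
Proof.
move=> fc x; elim=> [|n [m IH]]; first by exists 0 => y _ i.
have [k fk] := fc x n; exists (maxn m k) => y xy i.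
rewrite ltnS leq_eqVlt => /predU1P[->|i_n].
  by apply: fk; apply: agreeW xy; exact: leq_maxr.
by apply: IH i_n; apply: agreeW xy; exact: leq_maxl.
Qed.

Lemma seq_continuous_comp (S S' S'' : Type) (f : (nat -> S) -> (nat -> S'))
    (g : (nat -> S') -> (nat -> S'')) :
  seq_continuous f -> seq_continuous g -> seq_continuous (g \o f).
Proof.
move=> fc gc x n; have [m gm] := gc (f x) n; have [k fk] := fc x m.
by exists k => y /fk /gm.
Qed.

Lemma seq_continuous_reindex (S S' : Type) (e : nat -> nat) (h : S -> S') :
  seq_continuous (fun x n => h (x (e n))).
Proof.
apply: seq_continuous_coord => x i; exists (e i).+1 => y xy.
by rewrite xy.
Qed.

Lemma seq_closed_preimage (S S' : Type) (f : (nat -> S) -> (nat -> S'))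
    (K : set (nat -> S')) :
  seq_continuous f -> seq_closed K -> seq_closed (f @^-1` K).
Proof.
move=> fc cK x Kx; apply: cK => n; have [m fm] := fc x n.
by have [y Ky /fm xy] := Kx m; exists (f y).
Qed.

Lemma seq_closed_eq (S S' : Type) (f g : (nat -> S) -> (nat -> S')) :
  seq_continuous f -> seq_continuous g -> seq_closed [set x | f x = g x].
Proof.
move=> fc gc x fgx; apply/funext => i.
have [m fm] := fc x i.+1; have [k gk] := gc x i.+1.
have [y fgy xy] := fgx (maxn m k).
rewrite (fm y) //; last by apply: agreeW xy; exact: leq_maxl.
rewrite (gk y) ?fgy //; by apply: agreeW xy; exact: leq_maxr.
Qed.

Lemma seq_closedI (S : Type) (K L : set (nat -> S)) :
  seq_closed K -> seq_closed L -> seq_closed (K `&` L).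
Proof.
move=> cK cL x KL; split.
  by apply: cK => n; have [y [Ky _] xy] := KL n; exists y.
by apply: cL => n; have [y [_ Ly] xy] := KL n; exists y.
Qed.

Lemma seq_closed_bigcap (S I : Type) (K : I -> set (nat -> S)) :
  (forall i, seq_closed (K i)) -> seq_closed (\bigcap_i K i).
Proof.
move=> cK x Kx i _; apply: cK => n; have [y Ky xy] := Kx n.
by exists y => //; exact: Ky.
Qed.

Lemma seq_closed_coord (S : Type) (i : nat) (B : set S) :
  seq_closed [set x : nat -> S | B (x i)].
Proof.
by move=> x /(_ i.+1)[y /= By xy]; rewrite /= xy.
Qed.

Lemma analytic_image (S S' : Type) (f : (nat -> S) -> (nat -> S'))
    (A : set (nat -> S)) :
  seq_continuous f -> analytic A -> analytic (f @` A).
Proof.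
move=> fc [K [phi [cK cphi ->]]]; exists K, (f \o phi); split => //.
  exact: seq_continuous_comp.
by rewrite image_comp.
Qed.

Lemma analytic_closed (S : countType) (s0 : S) (K : set (nat -> S)) :
  seq_closed K -> analytic K.
Proof.
move=> cK; pose phi (a : nat -> nat) n := odflt s0 (unpickle (a n)).
have cphi : seq_continuous phi.
  exact: (seq_continuous_reindex id (fun k => odflt s0 (unpickle k))).
exists (phi @^-1` K), phi; split=> //; first exact: seq_closed_preimage.
apply/seteqP; split => [x Kx|x [a Ka <-]//].
have E : phi (pickle \o x) = x by apply/funext => n; rewrite /phi /= pickleK.
by exists (pickle \o x) => //=; rewrite E.
Qed.

Lemma analytic_bigcup (S : Type) (A : nat -> set (nat -> S)) :
  (forall j, analytic (A j)) -> analytic (\bigcup_j A j).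
Proof.
move=> aA.
have /choice[Kphi KphiP] : forall j, exists Kp : set (nat -> nat) * _,
    [/\ seq_closed Kp.1, seq_continuous Kp.2 & A j = Kp.2 @` Kp.1].
  by move=> j; have [K [phi ?]] := aA j; exists (K, phi).
pose tail (a : nat -> nat) n := a n.+1.
have tailP m (a b : nat -> nat) : agree m.+1 a b -> agree m (tail a) (tail b).
  by move=> ab i im; exact: ab.
(* The first entry selects a member of the union; the tail is a point of its closed set. *)
exists [set a | (Kphi (a 0)).1 (tail a)], (fun a => (Kphi (a 0)).2 (tail a)).
split.
- move=> a Ka; have [cK _ _] := KphiP (a 0).
  apply: cK => n; have [b Kb ab] := Ka n.+1.
  by exists (tail b); [rewrite ab|exact: tailP].
- move=> a n; have [_ cp _] := KphiP (a 0).
  have [m am] := cp (tail a) n; exists m.+1 => b ab.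
  by rewrite -(ab 0) //; apply: am; exact: tailP.
- apply/seteqP; split => [x [j _]|x [a Ka <-]].
    have [_ _ ->] := KphiP j => -[b Kb <-].
    by exists (fun n => if n is n'.+1 then b n' else j).
  by exists (a 0) => //; have [_ _ ->] := KphiP (a 0); exists (tail a).
Qed.

Definition slice (T : Type) (w : nat -> T) (j : nat) : nat -> T :=
  fun n => w (pickle (j, n)).

Definition unslice (T : Type) (g : nat -> nat -> T) : nat -> T :=
  fun n => let p := odflt (0, 0) (unpickle n) in g p.1 p.2.

Lemma unsliceK (T : Type) (g : nat -> nat -> T) j : slice (unslice g) j = g j.
Proof. by apply/funext => n; rewrite /slice /unslice pickleK. Qed.

Lemma seq_continuous_slice (T : Type) j :
  seq_continuous (fun w : nat -> T => slice w j).
Proof. exact: (seq_continuous_reindex (fun n => pickle (j, n)) id). Qed.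

Lemma analytic_bigcap (S : Type) (A : nat -> set (nat -> S)) :
  (forall j, analytic (A j)) -> analytic (\bigcap_j A j).
Proof.
move=> aA.
have /choice[Kphi KphiP] : forall j, exists Kp : set (nat -> nat) * _,
    [/\ seq_closed Kp.1, seq_continuous Kp.2 & A j = Kp.2 @` Kp.1].
  by move=> j; have [K [phi ?]] := aA j; exists (K, phi).
pose Psi j (a : nat -> nat) := (Kphi j).2 (slice a j).
have cPsi j : seq_continuous (Psi j).
  have [_ cp _] := KphiP j.
  exact: (seq_continuous_comp (@seq_continuous_slice _ j) cp).
(* The slices of one sequence code a preimage for each [A j]; the equations, a closed condition,
   force a common image. *)
exists (\bigcap_j ([set a | (Kphi j).1 (slice a j)]
                   `&` [set a | Psi j a = Psi 0 a])), (Psi 0).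
split => //.
- apply: seq_closed_bigcap => j; apply: seq_closedI; last exact: seq_closed_eq.
  have [cK _ _] := KphiP j.
  exact: (seq_closed_preimage (@seq_continuous_slice _ j) cK).
- apply/seteqP; split => [x Ax|x [a Ka <-] j _]; last first.
    have [/= Kaj <-] := Ka j I.
    by have [_ _ ->] := KphiP j; exists (slice a j).
  have /choice[g gP] : forall j, exists a, (Kphi j).1 a /\ (Kphi j).2 a = x.
    move=> j; have [_ _ Aj] := KphiP j; have := Ax j I; rewrite Aj.
    by move=> [a Ka <-]; exists a.
  have E j : Psi j (unslice g) = x by rewrite /Psi unsliceK; exact: (gP j).2.
  exists (unslice g) => // j _; split => /=; last by rewrite !E.
  by rewrite unsliceK; exact: (gP j).1.
Qed.

Lemma analyticI (S : Type) (A B : set (nat -> S)) :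
  analytic A -> analytic B -> analytic (A `&` B).
Proof.
move=> aA aB.
have -> : A `&` B = \bigcap_j (if j == 0 then A else B).
  apply/seteqP; split => [x [Ax Bx] j _|x ABx]; first by case: ifP.
  by split; [exact: (ABx 0)|exact: (ABx 1)].
by apply: analytic_bigcap => j; case: ifP.
Qed.

Lemma analytic_preimage (S : countType) (S' : Type) (s0 : S)
    (f : (nat -> S) -> (nat -> S')) (A : set (nat -> S')) :
  seq_continuous f -> analytic A -> analytic (f @^-1` A).
Proof.
move=> fc [K [phi [cK cphi ->]]].
pose p1 (w : nat -> S * nat) n := (w n).1.
pose p2 (w : nat -> S * nat) n := (w n).2.
have cp1 : seq_continuous p1 by exact: (seq_continuous_reindex id fst).
have cp2 : seq_continuous p2 by exact: (seq_continuous_reindex id snd).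
(* The preimage is the projection of the closed set of pairs (x, a) with [a] in [K] and
   [phi a = f x]. *)
have -> : f @^-1` (phi @` K) =
    p1 @` ((p2 @^-1` K) `&` [set w | phi (p2 w) = f (p1 w)]).
  apply/seteqP; split => [x [a Ka ax]|x [w [Kw /= E] <-]].
    by exists (fun n => (x n, a n)).
  by exists (p2 w).
apply: analytic_image => //; apply: (analytic_closed (s0, 0)).
apply: seq_closedI; first exact: seq_closed_preimage.
apply: seq_closed_eq.
  exact: (seq_continuous_comp cp2 cphi).
exact: (seq_continuous_comp cp1 fc).
Qed.

Definition cyl (T : Type) (s : seq T) : set (nat -> T) :=
  [set g | mkseq g (size s) = s].

Lemma cyl_mkseq (T : Type) (g h : nat -> T) n : cyl (mkseq g n) h <-> agree n g h.
Proof.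
rewrite /cyl /= size_mkseq; split => [E i i_n|gh].
  by have := congr1 (nth (g 0) ^~ i) E; rewrite !nth_mkseq.
by apply/esym/eq_in_map => i; rewrite mem_iota => /andP[_ /gh].
Qed.

Lemma cyl_rcons (T : Type) (s : seq T) g : cyl s g -> cyl (rcons s (g (size s))) g.
Proof. by rewrite /cyl /= size_rcons mkseqS => ->. Qed.

Lemma seq_closed_cyl (T : eqType) (s : seq T) : seq_closed (cyl s).
Proof.
move=> x /(_ (size s))[y sy xy]; rewrite /cyl /= -[RHS]sy.
by apply/eq_in_map => i; rewrite mem_iota => /andP[_ /xy].
Qed.

(** * Lusin's separation theorem *)

(** Inseparability of two pieces passes to some pair of one-letter extensions of their prefixes. The
    resulting branches have different images, which one coordinate separates on small cylinders. *)
Lemma analytic_separation (A B : set cantor_borel) :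
  analytic (A : set (nat -> bool)) -> analytic (B : set (nat -> bool)) ->
  A `&` B = set0 ->
  exists D : set cantor_borel, [/\ measurable D, A `<=` D & B `<=` ~` D].
Proof.
move=> [K [phi [cK cphi EA]]] [L [psi [cL cpsi EB]]] AB.
pose sep s t := exists D : set cantor_borel, [/\ measurable D,
  phi @` (K `&` cyl s) `<=` D & psi @` (L `&` cyl t) `<=` ~` D].
suff [D [mD AD BD]] : sep [::] [::].
  exists D; split => //; rewrite ?EA ?EB.
    by move=> _ [a Ka <-]; apply: AD; exists a.
  by move=> _ [a Ka <-]; apply: BD; exists a.
apply: contrapT => nsep0.
have split_sep s t : (forall i j, sep (rcons s i) (rcons t j)) -> sep s t.
  move=> sepst.
  have /choice[D DP] : forall ij : nat * nat, exists D : set cantor_borel,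
      [/\ measurable D, phi @` (K `&` cyl (rcons s ij.1)) `<=` D
        & psi @` (L `&` cyl (rcons t ij.2)) `<=` ~` D].
    by move=> [i j]; exact: sepst.
  exists (\bigcup_i \bigcap_j D (i, j)); split.
  - apply: bigcup_measurable => i _; apply: bigcapT_measurable => j.
    by have [] := DP (i, j).
  - move=> _ [a [Ka sa] <-]; exists (a (size s)) => // j _.
    have [_ + _] := DP (a (size s), j); apply.
    by exists a => //; split => //; exact: cyl_rcons.
  - move=> _ [a [La ta] <-] [i _ /(_ (a (size t)) I)].
    have [_ _] := DP (i, a (size t)); apply.
    by exists a => //; split => //; exact: cyl_rcons.
have /choice[N NP] : forall st : seq nat * seq nat, exists ij : nat * nat,
    ~ sep st.1 st.2 -> ~ sep (rcons st.1 ij.1) (rcons st.2 ij.2).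
  move=> [s t] /=.
  have [|nst] := pselect (sep s t); first by exists (0, 0).
  have /existsNP[i /existsNP[j ij]] := contra_not (@split_sep s t) nst.
  by exists (i, j).
pose st := fix st n := if n is n'.+1 then
  let p := st n' in (rcons p.1 (N p).1, rcons p.2 (N p).2) else ([::], [::]).
pose a n := (N (st n)).1; pose b n := (N (st n)).2.
have stE n : st n = (mkseq a n, mkseq b n).
  elim: n => [//|k IH]; rewrite !mkseqS /= /a /b.
  by rewrite IH.
have nsep n : ~ sep (mkseq a n) (mkseq b n).
  have : ~ sep (st n).1 (st n).2 by elim: n => [//|k IH]; exact: NP.
  by rewrite stE.
(* If no point of [K] had this prefix, the empty set would separate. *)
have Ka : K a.
  apply: cK => n; apply: contrapT => na; apply: (nsep n).
  exists set0; split; [exact: measurable0| |by rewrite setC0].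
  by move=> _ [c [Kc /cyl_mkseq ac] <-]; apply: na; exists c.
have Lb : L b.
  apply: (cL b) => k; apply: contrapT => nb; apply: (nsep k).
  exists setT; split; [exact: measurableT|by []|].
  by move=> _ [c [Lc /cyl_mkseq bc] <-]; case: nb; exists c.
have /existsNP[p pab] : ~ forall p, phi a p = psi b p.
  move=> /funext ab; suff : (A `&` B) (phi a) by rewrite AB.
  by split; [rewrite EA; exists a|rewrite EB ab; exists b].
have [m am] := cphi a p.+1; have [k bk] := cpsi b p.+1.
apply: (nsep (maxn m k)); exists [set x : cantor_borel | x p = phi a p]; split.
- have := @measurable_power_proj nat _ bool p measurableT [set phi a p].
  by rewrite setTI; apply.
- move=> _ [c [Kc /cyl_mkseq ac] <-] /=.
  by rewrite (am c) //; apply: agreeW ac; exact: leq_maxl.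
- move=> _ [c [Lc /cyl_mkseq bc] <-] /=.
  rewrite -(bk c) //; first exact: nesym.
  by apply: agreeW bc; exact: leq_maxr.
Qed.

(** * Borel sets are analytic *)

Definition bianalytic (S T : Type) (h : (nat -> S) -> T) : set (set T) :=
  [set A | analytic (h @^-1` A) /\ analytic (h @^-1` (~` A))].

(** Analytic sets are closed under countable unions and intersections but not under complements, so
    the complement is carried along. *)
Lemma sigma_algebra_bianalytic (S : countType) (s0 : S) (T : Type)
    (h : (nat -> S) -> T) :
  sigma_algebra setT (bianalytic h).
Proof.
have a0 : analytic (set0 : set (nat -> S)).
  by apply: (analytic_closed s0) => x /(_ 0)[].
have aT : analytic (setT : set (nat -> S)).
  exact: (analytic_closed s0).
split.
- by split; rewrite ?setC0 ?preimage_set0 ?preimage_setT.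
- by move=> A [aA aCA]; rewrite setTD; split => //; rewrite setCK.
- move=> A aA; split; last rewrite setC_bigcup.
    by rewrite preimage_bigcup; apply: analytic_bigcup => j; have [] := aA j.
  by rewrite preimage_bigcap; apply: analytic_bigcap => j; have [] := aA j.
Qed.

Definition unzip_seq (z : nat -> bool * bool) : cantor_borel * cantor_borel :=
  (fst \o z, snd \o z).

Lemma measurable_analytic (A : set (cantor_borel * cantor_borel)) :
  measurable A -> analytic (unzip_seq @^-1` A).
Proof.
move=> mA; suff [] : bianalytic unzip_seq A by [].
have sub (h : bool * bool -> bool) (B : set cantor_borel) : measurable B ->
    bianalytic (fun z => (h \o z : cantor_borel)) B.
  move: B; apply: smallest_sub.
    exact: (sigma_algebra_bianalytic (false, false)).
  move=> _ [i [C [_ ->]]]; split.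
    apply: (analytic_closed (false, false)).
    exact: (@seq_closed_coord _ i [set x | C (h x)]).
  apply: (analytic_closed (false, false)).
  exact: (@seq_closed_coord _ i [set x | ~ C (h x)]).
move: A mA; apply: smallest_sub.
  exact: (sigma_algebra_bianalytic (false, false)).
by move=> _ [[B mB <-]|[B mB <-]]; rewrite setTI; exact: sub.
Qed.

(** * Uniformization of Borel sets with countable sections *)

Lemma measurable_bool_eq d (T : measurableType d) (f g : T -> bool) :
  measurable_fun [set: T] f -> measurable_fun [set: T] g ->
  measurable [set x | f x = g x].
Proof.
move=> mf mg.
have -> : [set x | f x = g x] =
    (f @^-1` [set true] `&` g @^-1` [set true]) `|`
    (f @^-1` [set false] `&` g @^-1` [set false]).
  apply/seteqP; split => x /=; last by case=> -[-> ->].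
  by move=> ->; case: (g x); [left|right].
have mpre (h : T -> bool) b : measurable_fun [set: T] h -> measurable (h @^-1` [set b]).
  by move=> mh; rewrite -[X in measurable X]setTI; exact: mh.
by apply: measurableU; apply: measurableI; exact: mpre.
Qed.

Lemma measurable_cantor_eq d (T : measurableType d) (f g : T -> cantor_borel) :
  measurable_fun [set: T] f -> measurable_fun [set: T] g ->
  measurable [set x | f x = g x].
Proof.
move=> mf mg.
have -> : [set x | f x = g x] = \bigcap_i [set x | f x i = g x i].
  apply/seteqP; split => x /= fg; first by move=> i _ /=; rewrite fg.
  by apply/funext => i; exact: fg.
apply: bigcapT_measurable => i.
by apply: measurable_bool_eq; apply: (measurableT_comp (@measurable_power_proj nat _ bool i)).
Qed.

(** For each [p], the values of [u] at which bit [p] of [v] is true, respectively false, form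
    disjoint analytic sets; a Borel set separating them defines bit [p] of [g]. *)
Lemma functional_analytic_sub_graph (W : set (nat -> nat))
    (u v : (nat -> nat) -> cantor_borel) :
  seq_continuous u -> seq_continuous v -> analytic W ->
  (forall w w', W w -> W w' -> u w = u w' -> v w = v w') ->
  exists2 g : cantor_borel -> cantor_borel,
    measurable_fun [set: cantor_borel] g & forall w, W w -> g (u w) = v w.
Proof.
move=> cu cv aW Wf.
pose E p b : set cantor_borel := u @` (W `&` [set w | v w p = b]).
have aE p b : analytic (E p b).
  apply: analytic_image => //; apply: analyticI => //.
  apply: (analytic_closed 0).
  exact: (seq_closed_preimage cv (@seq_closed_coord _ p [set b])).
have /choice[D DP] : forall p, exists D : set cantor_borel,
    [/\ measurable D, E p true `<=` D & E p false `<=` ~` D].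
  move=> p; apply: analytic_separation => //.
  rewrite -subset0 => _ [[w [Ww wp] <-] [w' [Ww' wp'] uww']].
  have := Wf _ _ Ww' Ww uww'; move=> /(congr1 (@^~ p)).
  by rewrite wp wp'.
exists (fun x p => `[< D p x >]).
  apply: measurable_fun_power => p.
  apply: (@measurable_fun_bool _ _ _ _ true); rewrite setTI.
  have [mD _ _] := DP p.
  suff -> : (fun y => `[< D p y >]) @^-1` [set true] = D p by [].
  by apply/seteqP; split => y /= => [/asboolP|/asboolP].
move=> w Ww; apply/funext => p; have [_ Dt Df] := DP p.
case vp: (v w p).
  by apply/asboolP; apply: Dt; exists w.
by apply/asboolP; apply: Df; exists w.
Qed.

(** * Approximations, configurations and the splitting argument *)

Section countable_sections.
Variables (K : set (nat -> nat)) (u v : (nat -> nat) -> cantor_borel).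
Hypotheses (cK : seq_closed K) (cu : seq_continuous u) (cv : seq_continuous v).

Definition graphs (g : nat -> cantor_borel -> cantor_borel) :
    set (cantor_borel * cantor_borel) :=
  [set p | exists n, g n p.1 = p.2].

Lemma measurable_graphs g :
  (forall n, measurable_fun [set: cantor_borel] (g n)) -> measurable (graphs g).
Proof.
move=> mg.
have -> : graphs g = \bigcup_n [set p | g n p.1 = p.2].
  by apply/seteqP; split => p [n]; exists n.
apply: bigcup_measurable => n _.
apply: (@measurable_cantor_eq _ _ (g n \o fst) snd).
  exact: measurableT_comp.
exact: measurable_snd.
Qed.

Definition config (N : set (cantor_borel * cantor_borel)) (k : nat)
    (gam : nat -> nat -> nat) : Prop :=
  forall j, j < k ->
    [/\ K (gam j), u (gam j) = u (gam 0) & ~ N (u (gam j), v (gam j))].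

Definition extends (a : seq (seq nat)) (gam : nat -> nat -> nat) : Prop :=
  forall j, j < size a -> cyl (nth [::] a j) (gam j).

Definition bad (a : seq (seq nat)) : Prop :=
  exists2 g, forall n, measurable_fun [set: cantor_borel] (g n) &
    forall gam, config (graphs g) (size a) gam -> ~ extends a gam.

(** A family [gam] is coded by the slices of one sequence; slices beyond [size a] are
    unconstrained. *)
Lemma analytic_config g (a : seq (seq nat)) :
  (forall n, measurable_fun [set: cantor_borel] (g n)) ->
  analytic [set w : nat -> nat |
    config (graphs g) (size a) (slice w) /\ extends a (slice w)].
Proof.
move=> mg.
pose N' : set (nat -> bool * bool) := unzip_seq @^-1` (~` graphs g).
have aN' : analytic N'.
  by apply: measurable_analytic; apply: measurableC; exact: measurable_graphs.
pose uv (w : nat -> nat) : nat -> bool * bool := fun n => (u w n, v w n).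
have cuv : seq_continuous uv.
  move=> w n; have [m um] := cu w n; have [k vk] := cv w n.
  exists (maxn m k) => w' ww' i i_n; rewrite /uv (um w') ?(vk w') //.
    by apply: agreeW ww'; exact: leq_maxr.
  by apply: agreeW ww'; exact: leq_maxl.
pose cs j := @seq_continuous_slice nat j.
pose W j : set (nat -> nat) := [set w | j < size a ->
  [/\ K (slice w j), u (slice w j) = u (slice w 0), ~ graphs g (u (slice w j), v (slice w j))
    & cyl (nth [::] a j) (slice w j)]].
have -> : [set w : nat -> nat |
    config (graphs g) (size a) (slice w) /\ extends a (slice w)] = \bigcap_j W j.
  apply/seteqP; split => [w [cw ew] j _ ja|w Ww].
    by have [] := cw j ja; split => //; exact: ew.
  by split=> j ja; have [] := Ww j I ja.
apply: analytic_bigcap => j.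
have [ja|ja] := ltnP j (size a); last first.
  apply: (analytic_closed 0) => w _ /= ja'.
  by rewrite ltnNge ja in ja'.
have -> : W j = ((fun w => slice w j) @^-1` K
    `&` [set w | (u \o (fun w => slice w j)) w = (u \o (fun w => slice w 0)) w])
    `&` ((uv \o (fun w => slice w j)) @^-1` N'
    `&` (fun w => slice w j) @^-1` (cyl (nth [::] a j))).
  apply/seteqP; split => [w Ww|w [[/= Kw uw] [Nw cw]] _]; last by split.
  by have [] := Ww ja.
apply: analyticI; last apply: analyticI.
- apply: (analytic_closed 0); apply: seq_closedI.
    exact: seq_closed_preimage.
  by apply: seq_closed_eq; exact: seq_continuous_comp.
- by apply: (analytic_preimage 0) => //; exact: seq_continuous_comp.
- by apply: (analytic_closed 0); apply: seq_closed_preimage => //; exact: seq_closed_cyl.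
Qed.

Lemma exists_bad_cover : exists2 g : nat -> cantor_borel -> cantor_borel,
  forall n, measurable_fun [set: cantor_borel] (g n) &
  forall a, bad a ->
    forall gam, config (graphs g) (size a) gam -> ~ extends a gam.
Proof.
have /choice[G GP] : forall a, exists g : nat -> cantor_borel -> cantor_borel,
    (forall n, measurable_fun [set: cantor_borel] (g n)) /\
    (bad a -> forall gam, config (graphs g) (size a) gam -> ~ extends a gam).
  move=> a; have [[g mg gP]|nb] := pselect (bad a); first by exists g.
  by exists (fun=> id); split => // n; exact: measurable_id.
pose dec n : seq (seq nat) * nat := odflt ([::], 0) (unpickle n).
exists (fun n => G (dec n).1 (dec n).2) => [n|a ba gam cgam].
  by have [] := GP (dec n).1.
have [_ /(_ ba gam)] := GP a; apply => j ja; have [Kj uj Nj] := cgam j ja.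
split => // -[n En]; apply: Nj; exists (pickle (a, n)).
by rewrite /dec pickleK.
Qed.

Section splitting.
Variable g : nat -> cantor_borel -> cantor_borel.
Hypothesis mg : forall n, measurable_fun [set: cantor_borel] (g n).
Hypothesis gP : forall a, bad a ->
  forall gam, config (graphs g) (size a) gam -> ~ extends a gam.

(* Otherwise the i-th points of the configurations extending a would form an
   analytic set with at most one point in each section, hence lie in a Borel
   graph, and a would be bad. *)
Lemma config_two_values a i gam : i < size a ->
  config (graphs g) (size a) gam -> extends a gam ->
  exists gam1 gam2,
    [/\ config (graphs g) (size a) gam1 /\ extends a gam1,
        config (graphs g) (size a) gam2 /\ extends a gam2,
        u (gam1 0) = u (gam2 0) & v (gam1 i) <> v (gam2 i)].
Proof.
move=> ia cgam egam; apply: contrapT => H.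
have [] := @functional_analytic_sub_graph _ (u \o (fun w => slice w 0))
  (v \o (fun w => slice w i)) _ _ (analytic_config a mg).
- exact: (seq_continuous_comp (@seq_continuous_slice _ 0) cu).
- exact: (seq_continuous_comp (@seq_continuous_slice _ i) cv).
- move=> w w' Ww Ww' /= uw; apply: contrapT => vw; apply: H.
  by exists (slice w), (slice w').
move=> h mh hP.
have ba : bad a.
  exists (fun n => if n is k.+1 then g k else h) => [[//|k]|gam' c' e'].
    exact: mg.
  have c : config (graphs g) (size a) gam'.
    move=> j ja; have [Kj uj Nj] := c' j ja; split => // -[n En].
    by apply: Nj; exists n.+1.
  have [_ ui Ni] := c' i ia; apply: Ni; exists 0 => /=.
  have E j : slice (unslice gam') j = gam' j by exact: unsliceK.
  have := hP (unslice gam'); rewrite /= !E ui; apply.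
  have -> : slice (unslice gam') = gam' by apply/funext => j; rewrite E.
  by [].
exact: (gP ba cgam egam).
Qed.

(** One [p] serves for all extensions of the two prefixes, so separation survives in limits of
    branches. *)
Definition separated m (x y : nat -> nat) : Prop :=
  exists p, forall w w', agree m x w -> agree m y w' -> v w p <> v w' p.

(** [config_two_values], applied to the prefixes of length [m], gives two configurations over the
    same value of [u]. The first supplies the old leaves, the [i]-th point of the second the new
    leaf; continuity of [v] fixes their difference on prefixes. *)
Lemma config_split k gam m i : i < k -> config (graphs g) k gam ->
  exists gam' m', [/\ m <= m', config (graphs g) k.+1 gam',
    forall j, j < k -> agree m (gam j) (gam' j),
    agree m (gam i) (gam' k) & separated m' (gam' i) (gam' k)].
Proof.
move=> ik cgam.
pose a := mkseq (fun j => mkseq (gam j) m) k.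
have sa : size a = k by rewrite size_mkseq.
have ea gam' : extends a gam' <-> forall j, j < k -> agree m (gam j) (gam' j).
  split=> [eg j jk|eg j].
    by have := eg j; rewrite sa nth_mkseq // => /(_ jk) /cyl_mkseq.
  by rewrite sa => jk; rewrite nth_mkseq //; apply/cyl_mkseq; exact: eg.
have [] := @config_two_values a i gam; rewrite ?sa //.
  by apply/ea.
move=> g1 [g2 [[c1 e1] [c2 e2] u12 v12]].
move/ea: e1 => e1; move/ea: e2 => e2.
have /existsNP[p vp] : ~ forall p, v (g1 i) p = v (g2 i) p by move=> /funext.
have [m1 m1P] := cv (g1 i) p.+1; have [m2 m2P] := cv (g2 i) p.+1.
exists (fun j => if j < k then g1 j else g2 i), (maxn m (maxn m1 m2)); split.
- exact: leq_maxl.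
- have k0 : 0 < k by exact: leq_ltn_trans ik.
  move=> j jk; rewrite k0; case: ifP => [/c1//|_].
  by have [] := c2 i ik; rewrite u12.
- by move=> j jk; rewrite jk; exact: e1.
- by rewrite ltnn; exact: e2.
- rewrite ik ltnn; exists p => w w' ww ww'.
  rewrite -(m1P w) //; last by apply: agreeW ww; rewrite !leq_max leqnn orbT.
  by rewrite -(m2P w') //; apply: agreeW ww'; rewrite !leq_max leqnn !orbT.
Qed.

Lemma agree_trans m (x y z : nat -> nat) :
  agree m x y -> agree m y z -> agree m x z.
Proof. by move=> xy yz i im; rewrite xy // yz. Qed.

Lemma separatedW m m' x y x' y' : m <= m' -> agree m x x' -> agree m y y' ->
  separated m x y -> separated m' x' y'.
Proof.
move=> mm' xx' yy' [p pP]; exists p => w w' xw yw'.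
apply: pP; first exact: (agree_trans xx' (agreeW mm' xw)).
exact: (agree_trans yy' (agreeW mm' yw')).
Qed.

(** The leaves are split one after another; after [l] steps each leaf [j < l] has the partner
    [k + j]. *)
Lemma config_double k gam m : config (graphs g) k gam ->
  exists gam' m', [/\ m < m', config (graphs g) (k + k) gam' &
    forall j, j < k -> [/\ agree m (gam j) (gam' j),
      agree m (gam j) (gam' (k + j)) & separated m' (gam' j) (gam' (k + j))]].
Proof.
move=> cgam.
suff H l : l <= k -> exists gam' m', [/\ m <= m', config (graphs g) (k + l) gam',
    forall j, j < k -> agree m (gam j) (gam' j) &
    forall j, j < l -> agree m (gam j) (gam' (k + j)) /\
      separated m' (gam' j) (gam' (k + j))].
  have [gam' [m' [mm' cg' ag' sg']]] := H k (leqnn k).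
  (* The successor makes the prefix lengths strictly increase, so that branches converge. *)
  exists gam', m'.+1; split => // j jk; have [akj sj] := sg' j jk.
  split => //; first exact: ag'.
  exact: (separatedW (leqnSn m') _ _ sj).
elim: l => [_|l IH lk].
  by exists gam, m; split => //; rewrite addn0.
have [g1 [m1 [mm1 c1 a1 s1]]] := IH (ltnW lk).
have [||g2 [m2 [m12 c2 a2 al s2]]] := @config_split (k + l) g1 m1 l.
- exact: ltn_addr.
- exact: c1.
exists g2, m2; split; first exact: leq_trans m12.
- by rewrite addnS.
- move=> j jk; apply: (agree_trans (a1 j jk)); apply: (agreeW mm1).
  by apply: a2; exact: ltn_addr.
- move=> j; rewrite ltnS leq_eqVlt => /predU1P[->|jl].
    split=> //; apply: (agree_trans (a1 l lk)); exact: (agreeW mm1).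
  have [aj sj] := s1 j jl; split.
    apply: (agree_trans aj); apply: (agreeW mm1); apply: a2.
    by rewrite ltn_add2l.
  apply: separatedW sj => //; apply: a2; last by rewrite ltn_add2l.
  by apply: ltn_addr; exact: ltn_trans lk.
Qed.

Hypothesis section_countable : forall x, countable [set v w | w in [set w | K w /\ u w = x]].

Lemma no_config gam : ~ config (graphs g) 1 gam.
Proof.
move=> cgam.
have /choice[next nextP] : forall s : nat * (nat -> nat -> nat) * nat,
    exists s' : nat * (nat -> nat -> nat) * nat,
    config (graphs g) s.1.1 s.1.2 ->
    [/\ s'.1.1 = s.1.1 + s.1.1, s.2 < s'.2, config (graphs g) s'.1.1 s'.1.2 &
      forall j, j < s.1.1 -> [/\ agree s.2 (s.1.2 j) (s'.1.2 j),
        agree s.2 (s.1.2 j) (s'.1.2 (s.1.1 + j)) &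
        separated s'.2 (s'.1.2 j) (s'.1.2 (s.1.1 + j))]].
  move=> [[k h] m] /=.
  have [c|nc] := pselect (config (graphs g) k h); last by exists (k, h, m).
  by have [h' [m' [? ? ?]]] := config_double m c; exists (k + k, h', m').
pose st n := iter n next (1, gam, 0).
pose k n := (st n).1.1; pose h n := (st n).1.2; pose m n := (st n).2.
have ch n : config (graphs g) (k n) (h n).
  by elim: n => [//|n IH]; have [] := nextP _ IH.
have stP n := nextP (st n) (ch n).
have kS n : k n.+1 = k n + k n by have [] := stP n.
have k0 n : 0 < k n by elim: n => [//|n IH]; rewrite kS ltn_addr.
have mS n : m n < m n.+1 by have [] := stP n.
have mn n : n <= m n by elim: n => [//|n IH]; exact: leq_ltn_trans (mS n).
(* A branch of the tree: leaf [j] of level [n] has the children [j] and [k n + j]. *)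
pose thread b := forall n, b n < k n /\ (b n.+1 = b n \/ b n.+1 = k n + b n).
(* Coordinate [i] is settled at level [i.+1], because [i < m i.+1]. *)
pose limit (b : nat -> nat) i := h i.+1 (b i.+1) i.
have limitP b n : thread b -> agree (m n) (h n (b n)) (limit b).
  move=> tb.
  have step i : agree (m i) (h i (b i)) (h i.+1 (b i.+1)).
    have [bi bS] := tb i; have [_ _ _ /(_ _ bi)[a1 a2 _]] := stP i.
    by case: bS => ->.
  have mle i j : i <= j -> m i <= m j.
    move=> /subnK <-; elim: (j - i) => [//|d IH].
    by apply: leq_trans IH _; exact: ltnW.
  have chain i j : i <= j -> agree (m i) (h i (b i)) (h j (b j)).
    move=> /subnK <-; elim: (j - i) => [//|d IH].
    apply: (agree_trans IH); apply: (agreeW _ (step _)).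
    by apply: mle; exact: leq_addl.
  move=> i im; rewrite /limit.
  have [ni|ni] := leqP n i.+1; first exact: (chain _ _ ni).
  by rewrite (chain i.+1 n) //; exact: ltnW.
have thread0 : thread (fun=> 0) by move=> n; split => //; left.
have limitK b : thread b -> K (limit b).
  move=> tb; apply: cK => n; exists (h n (b n)).
    by have [] := ch n _ (tb n).1.
  by apply: agree_sym; apply: agreeW (limitP b n tb).
(* Leaves of one level share their value of [u], and continuity passes this to the limits. *)
have limitu b : thread b -> u (limit b) = u (limit (fun=> 0)).
  move=> tb; apply/funext => p.
  have [m1 P1] := cu (limit b) p.+1.
  have [m2 P2] := cu (limit (fun=> 0)) p.+1.
  pose n := maxn m1 m2.
  have agn c l : l <= n -> thread c -> agree l (limit c) (h n (c n)).
    move=> ln tc; apply: agree_sym; apply: agreeW (limitP c n tc).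
    exact: leq_trans ln (mn n).
  rewrite (P1 (h n (b n))) //; last by apply: agn => //; exact: leq_maxl.
  rewrite (P2 (h n 0)) //; last first.
    by apply: (agn (fun=> 0)) => //; exact: leq_maxr.
  by have [_ ->] := ch n _ (tb n).1.
set x := u (limit (fun=> 0)) in limitu.
have /countable_injP[f finj] := section_countable x.
(* [f] numbers the values of [v] in the section over [x]; the step from level [n] to level [n.+1] is
   to exclude value number [n]. *)
pose avoids n j := forall w, K w -> u w = x -> f (v w) = n ->
  ~ agree (m n.+1) (h n.+1 j) w.
have /choice[child childP] : forall nj : nat * nat, exists j',
    nj.2 < k nj.1 -> (j' = nj.2 \/ j' = k nj.1 + nj.2) /\ avoids nj.1 j'.
  move=> [n j] /=; have [jk|] := ltnP j (k n); last by exists 0.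
  have [av|nav] := pselect (avoids n j); first by exists j; split => //; left.
  (* If both children kept points with value number [n], injectivity of [f] would make their values
     equal, against the separation. *)
  exists (k n + j) => _; split; first by right.
  move=> w' Kw' uw' fw' agw'; apply: nav => w Kw uw fw agw.
  have [_ _ _ /(_ _ jk)[_ _ [p pP]]] := stP n.
  apply: (pP w w') => //; congr (_ p); apply: finj.
  - by apply/mem_set; exists w.
  - by apply/mem_set; exists w'.
  - by rewrite fw fw'.
pose b := fix b n := if n is n'.+1 then child (n', b n') else 0.
have bk n : b n < k n.
  elim: n => [|n IH]; first exact: k0.
  have [+ _] := childP (n, b n) IH; rewrite kS => -[] /= ->.
    by rewrite ltn_addr.
  by rewrite ltn_add2l.
have tb : thread b by move=> n; split => //; have [] := childP (n, b n) (bk n).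
(* The limit of the branch meets the step that excluded its own value. *)
have [_ av] := childP (f (v (limit b)), b (f (v (limit b)))) (bk _).
apply: (av (limit b)) => //; [exact: limitK|exact: limitu|].
exact: (limitP b (f (v (limit b))).+1 tb).
Qed.

End splitting.

Lemma countable_sections_graphs :
  (forall x, countable [set v w | w in [set w | K w /\ u w = x]]) ->
  exists2 g : nat -> cantor_borel -> cantor_borel,
    forall n, measurable_fun [set: cantor_borel] (g n) &
    forall w, K w -> graphs g (u w, v w).
Proof.
move=> cnt; have [g mg gP] := exists_bad_cover.
exists g => // w Kw; apply: contrapT => Nw.
(* A point off the graphs is by itself a configuration with one leaf. *)
by apply: (no_config mg gP cnt (gam := fun=> w)) => j _; split.
Qed.

End countable_sections.

Theorem lusin_novikov (P : set (cantor_borel * cantor_borel)) :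
  measurable P -> (forall x, countable [set y | P (x, y)]) ->
  exists2 g : nat -> cantor_borel -> cantor_borel,
    forall n, measurable_fun [set: cantor_borel] (g n) &
    forall x y, P (x, y) -> exists n, g n x = y.
Proof.
move=> /measurable_analytic[K [phi [cK cphi EP]]] cntP.
pose u (w : nat -> nat) : cantor_borel := fst \o phi w.
pose v (w : nat -> nat) : cantor_borel := snd \o phi w.
have cu : seq_continuous u.
  exact: (seq_continuous_comp cphi (seq_continuous_reindex id fst)).
have cv : seq_continuous v.
  exact: (seq_continuous_comp cphi (seq_continuous_reindex id snd)).
have PK w : K w -> P (u w, v w).
  move=> Kw; suff : (unzip_seq @^-1` P) (phi w) by [].
  by rewrite EP; exists w.
have [|g mg gP] := countable_sections_graphs cK cu cv.
  move=> x; apply: sub_countable (cntP x); apply: subset_card_le.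
  by move=> _ [w [Kw <-] <-]; exact: PK.
exists g => // x y Pxy.
have : (unzip_seq @^-1` P) (fun n => (x n, y n)) by [].
rewrite EP => -[w Kw Ew].
have [n En] := gP w Kw; exists n; move: En; rewrite /u /v Ew.
by [].
Qed.

(** * Standard Borel spaces *)

Lemma measurable_exists d (T : measurableType d) (I : countType)
    (F : I -> set T) :
  (forall i, measurable (F i)) -> measurable [set x | exists i, F i x].
Proof.
move=> mF.
have -> : [set x | exists i, F i x] =
    \bigcup_n (if unpickle n is Some i then F i else set0).
  apply/seteqP; split => [x [i Fx]|x [n _]].
    by exists (pickle i) => //; rewrite pickleK.
  by case: unpickle => [i Fx|//]; exists i.
by apply: bigcup_measurable => n _; case: unpickle.
Qed.

Lemma measurable_forall d (T : measurableType d) (I : countType)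
    (F : I -> set T) :
  (forall i, measurable (F i)) -> measurable [set x | forall i, F i x].
Proof.
move=> mF.
have -> : [set x | forall i, F i x] = ~` [set x | exists i, (~` F i) x].
  apply/seteqP; split => [x Fx [i]|x Fx i]; first exact.
  by apply: contrapT => nFx; apply: Fx; exists i.
by apply: measurableC; apply: measurable_exists => i; exact: measurableC.
Qed.

Lemma measurable_imply d (T : measurableType d) (F G : set T) :
  measurable F -> measurable G -> measurable [set x | F x -> G x].
Proof.
move=> mF mG.
have -> : [set x | F x -> G x] = ~` F `|` G.
  apply/seteqP; split => [x FG|x [nFx /nFx//|Gx _//]].
  by have [/FG|] := pselect (F x); [right|left].
by apply: measurableU => //; exact: measurableC.
Qed.

Lemma measurable_const d (T : measurableType d) (c : Prop) :
  measurable [set _ : T | c].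
Proof.
have [Hc|nc] := pselect c.
  by have -> : [set _ : T | c] = setT by apply/seteqP; split.
by have -> : [set _ : T | c] = set0 by apply/seteqP; split.
Qed.

Lemma measurable_power_bit (I : Type) (i : I) (b : bool) :
  measurable [set z : power I bool | z i = b].
Proof.
have := @measurable_power_proj I _ bool i measurableT [set b].
by rewrite setTI; apply.
Qed.

(** * Inverse powers of two *)

Section pow2.
Local Open Scope ring_scope.
Variable R : realType.

Lemma pow2V_gt0 n : 0 < 2 ^- n :> R.
Proof. by rewrite invr_gt0 exprn_gt0. Qed.

Lemma pow2V_le m n : (2 ^- m <= 2 ^- n :> R) = (n <= m)%N.
Proof. by rewrite lef_pV2 ?posrE ?exprn_gt0 // ler_eXn2l // ltr1n. Qed.

Lemma pow2V_lt (e : R) : 0 < e -> exists n, 2 ^- n < e.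
Proof.
move=> e0; exists (Num.bound e^-1); rewrite invf_plt ?posrE ?exprn_gt0 //.
apply: lt_trans (archi_boundP _) _; first by rewrite invr_ge0 ltW.
by rewrite -natrX ltr_nat ltn_expl.
Qed.

Lemma pow2V_split n : 2 ^- n = 2 ^- n.+1 + 2 ^- n.+1 :> R.
Proof. by rewrite exprSr invfM -splitr. Qed.

Lemma le_pow2V (x y : R) : (forall n, x <= y + 2 ^- n) -> x <= y.
Proof.
move=> H; apply/ler_addgt0Pr => e /pow2V_lt[n ne].
by apply: le_trans (H n) _; rewrite lerD2l ltW.
Qed.

End pow2.

(* R is a phantom parameter: it fixes the field in which the distance, 2^-n with n
   the least code of an index at which the two functions differ, takes values. *)
Definition bool_metric (R : realType) (I : countType) : Type := I -> bool.

(** * A Polish metric on the functions from a countable type to [bool] *)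

Section bool_metric.
Local Open Scope ring_scope.
Variables (R : realType) (I : countType).
Implicit Types f g : bool_metric R I.

HB.instance Definition _ := Choice.copy (bool_metric R I) (I -> bool).

Definition bagree n f g : Prop := forall i, (pickle i < n)%N -> f i = g i.

Definition differ f g n : bool := `[< exists2 i, pickle i = n & f i <> g i >].

Definition bdist f g : R :=
  if pselect (exists n, differ f g n) is left e then 2 ^- ex_minn e else 0.

Lemma bdist_le f g n : bdist f g <= 2 ^- n <-> bagree n f g.
Proof.
rewrite /bdist; case: pselect => [e|ne]; last first.
  split=> [_ i _|_]; last exact/ltW/pow2V_gt0.
  apply: contrapT => fg; apply: ne; exists (pickle i).
  by apply/asboolP; exists i.
case: ex_minnP => m /asboolP[j jm fgj] mmin.
rewrite pow2V_le; split => [nm i i_n|ag].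
  apply: contrapT => fg; suff /mmin : differ f g (pickle i).
    by rewrite leqNgt (leq_trans i_n nm).
  by apply/asboolP; exists i.
by rewrite leqNgt; apply/negP => mn; apply: fgj; apply: ag; rewrite jm.
Qed.

Lemma bdist_cases f g : f = g /\ bdist f g = 0 \/ exists n, bdist f g = 2 ^- n.
Proof.
rewrite /bdist; case: pselect => [e|ne]; first by right; exists (ex_minn e).
left; split => //; apply/funext => i; apply: contrapT => fg.
by apply: ne; exists (pickle i); apply/asboolP; exists i.
Qed.

Lemma bdistxx f : bdist f f = 0.
Proof.
by rewrite /bdist; case: pselect => // e; have [n /asboolP[i]] := e.
Qed.

Lemma bdist_eq0 f g : bdist f g = 0 -> f = g.
Proof.
move=> fg; apply/funext => i; have := (bdist_le f g (pickle i).+1).1; apply => //.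
by rewrite fg ltW ?pow2V_gt0.
Qed.

Lemma bdist_sym f g : bdist f g = bdist g f.
Proof.
suff le f' g' : bdist f' g' <= bdist g' f' by apply/eqP; rewrite eq_le !le.
have [[-> _//]|[n E]] := bdist_cases g' f'.
rewrite E; apply/bdist_le => i i_n; apply/esym; move: i i_n.
by apply/bdist_le; rewrite E.
Qed.

Lemma bdist_triangle g f h : bdist f h <= bdist f g + bdist g h.
Proof.
have [[-> ->]|[n En]] := bdist_cases f g; first by rewrite add0r.
have [[-> ->]|[m Em]] := bdist_cases g h; first by rewrite addr0.
have agn : bagree n f g by apply/bdist_le; rewrite En.
have agm : bagree m g h by apply/bdist_le; rewrite Em.
(* The larger of the two distances already bounds [bdist f h]: the distance is an ultrametric. *)
have [nm|mn] := leqP n m.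
  apply: (@le_trans _ _ (bdist f g)); last by rewrite lerDl Em ltW ?pow2V_gt0.
  rewrite En; apply/bdist_le => i i_n; rewrite agn // agm //.
  exact: leq_trans nm.
apply: (@le_trans _ _ (bdist g h)); last by rewrite lerDr En ltW ?pow2V_gt0.
rewrite Em; apply/bdist_le => i i_m; rewrite agn ?agm //.
exact: ltn_trans mn.
Qed.

HB.instance Definition _ := @isMetric.Build R (bool_metric R I) bdist
  bdistxx bdist_eq0 bdist_sym bdist_triangle.

Lemma bool_metric_ball f n g : ball f (2 ^- n) g -> bagree n f g.
Proof. by rewrite ballEmdist /= => fg; apply/bdist_le; exact: ltW. Qed.

Lemma bool_metric_sub_ball f e : 0 < e ->
  exists n, forall g, bagree n f g -> ball f e g.
Proof.
move=> /pow2V_lt[n ne]; exists n => g fg; rewrite ballEmdist /=.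
by apply: le_lt_trans ne; apply/bdist_le.
Qed.

(** Characteristic functions of finite lists form the countable dense set; this list approximates
    [f]. *)
Definition prefix_set n f : seq I := [seq i <- pmap unpickle (iota 0 n) | f i].

Lemma bagree_prefix_set n f : bagree n f (fun i => i \in prefix_set n f).
Proof.
move=> i i_n; rewrite mem_filter mem_pmap; case: (f i) => //=.
apply/esym/mapP; exists (pickle i); last by rewrite pickleK.
by rewrite mem_iota.
Qed.

Lemma polish_bool_metric : polish (bool_metric R I).
Proof.
split.
  move=> F FF /cauchyP cF.
  have /choice[x xP] : forall n, exists x : bool_metric R I, F (ball x (2 ^- n : R)).
    by move=> n; apply: cF; exact: pow2V_gt0.
  (* A ball of radius [2 ^- n] fixes the indices with code below [n], hence the successor. *)
  pose l : bool_metric R I := fun i => x (pickle i).+1 i.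
  have lP n : bagree n (x n) l.
    move=> i i_n.
    have [y [y1 y2]] := filter_ex (filterI (xP n) (xP (pickle i).+1)).
    rewrite (bool_metric_ball y1) // /l; apply/esym.
    exact: (bool_metric_ball y2).
  exists l => A /nbhs_ballP[e /= e0 eA].
  have [n nP] := bool_metric_sub_ball l e0.
  apply: filterS (xP n) => y /bool_metric_ball xy; apply/eA/nP => i i_n.
  by rewrite -xy // lP.
exists (range (fun (s : seq I) => (fun i => i \in s) : bool_metric R I)).
  apply: (card_le_trans (card_image_le _ _)); exact: countableP.
move=> O [x Ox] oO.
have /nbhs_ballP[e /= e0 eO] : nbhs x O by exact: open_nbhs_nbhs.
have [n nP] := bool_metric_sub_ball x e0.
exists (fun i => i \in prefix_set n x); split; last by exists (prefix_set n x).
exact/eO/nP/bagree_prefix_set.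
Qed.

Lemma standard_borel_power_bool : standard_borel R (power I bool).
Proof.
exists (bool_metric R I), id; split.
- exact: polish_bool_metric.
- by exists id.
- move=> B; split.
    move: B; apply: smallest_sub.
      split; first exact: measurable0.
      - by move=> A mA; rewrite setTD; exact: measurableC.
      - by move=> A mA; exact: bigcupT_measurable.
    move=> O oO.
    (* An open set is a countable union of basic sets, each given by a length and a finite list. *)
    have -> : O = [set z : power I bool | exists ns : nat * seq I,
        (forall y, bagree ns.1 (fun i => i \in ns.2) y -> O y) /\
        bagree ns.1 (fun i => i \in ns.2) z].
      apply/seteqP; split => [x Ox|x [ns [nsO]]]; last exact: nsO.
      have /nbhs_ballP[e /= e0 eO] : nbhs x O by exact: open_nbhs_nbhs.
      have [n nP] := bool_metric_sub_ball x e0.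
      have xn := @bagree_prefix_set n x.
      exists (n, prefix_set n x) => /=; split=> [y xy|i i_n].
        by apply/eO/nP => i i_n; rewrite xn // xy.
      by rewrite xn.
    apply: measurable_exists => ns; apply: measurableI.
      exact: measurable_const.
    apply: (@measurable_forall _ (power I bool)) => i; apply: measurable_imply.
      exact: measurable_const.
    have := @measurable_power_bit I i (i \in ns.2).
    by congr measurable; apply/seteqP; split => z /= ->.
  move: B; apply: smallest_sub.
    split; first exact: sigma_algebra0.
    - by move=> A mA; rewrite setTD; exact: sigma_algebraC.
    - by move=> A mA; exact: sigma_algebra_bigcup.
  move=> _ [i [A [_ ->]]]; apply: sub_sigma_algebra.
  rewrite openE => x /= Ax; apply/nbhs_ballP.
  exists (2 ^- (pickle i).+1) => /=; first exact: pow2V_gt0.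
  by move=> y /bool_metric_ball xy /=; rewrite -xy.
Qed.

End bool_metric.

(** * Polish spaces as Borel retracts of the Cantor space *)

Section metric_retract.
Local Open Scope ring_scope.
Variables (R : realType) (P : metricType R).
Hypothesis complete : forall F : set_system P, ProperFilter F -> cauchy F ->
  exists l : P, F --> l.

(** Any choice of one point in each [B k] is Cauchy; since the bound compares all pairs, its limit
    serves every point of every [B k]. *)
Lemma complete_nested_limit (B : nat -> set P) :
  (forall k, B k !=set0) ->
  (forall k n x y, B k x -> B n y -> mdist x y <= 2 ^- k + 2 ^- n) ->
  exists l, forall k x, B k x -> mdist x l <= 2 ^- k.
Proof.
move=> /choice[s sB] BB.
have cs : cauchy (s n @[n --> \oo]).
  apply: cauchy_exP => e e0.
  have [k ke] : exists k, 2 ^- k < e / 2 by apply: pow2V_lt; rewrite divr_gt0.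
  exists (s k); exists k => // n /= kn; rewrite ballEmdist /=.
  apply: le_lt_trans (BB _ _ _ _ (sB k) (sB n)) _.
  rewrite (splitr e) ltr_leD // (le_trans _ (ltW ke)) //.
  by rewrite pow2V_le.
have [l sl] := complete _ cs.
exists l => k x Bx; apply: le_pow2V => n.
have e0 : 0 < 2 ^- n.+1 :> R by exact: pow2V_gt0.
have [N _ NP] : \forall i \near \oo, ball l (2 ^- n.+1 : R) (s i).
  by apply: sl; exact: nbhsx_ballx.
have := NP (maxn N n.+1) (leq_maxl _ _); set i := maxn N n.+1.
rewrite ballEmdist /= metric_sym => lsi.
apply: le_trans (metric_triangle x (s i) l) _.
apply: le_trans (lerD (BB _ _ _ _ Bx (sB i)) (ltW lsi)) _.
rewrite -addrA lerD2l.
by rewrite [leRHS]pow2V_split lerD2r pow2V_le leq_maxr.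
Qed.

Variable e : nat -> P.
Hypothesis dense_e : forall x k, exists i, mdist (e i) x < 2 ^- k.

Definition bits (x : P) : cantor_borel :=
  fun n => let p : nat * nat := odflt (0%N, 0%N) (unpickle n) in
  mdist (e p.1) x < 2 ^- p.2.

Lemma bitsE x i k : bits x (pickle (i, k)) = (mdist (e i) x < 2 ^- k).
Proof. by rewrite /bits pickleK. Qed.

(** A Borel condition, met by every [bits x], under which the centres selected by [z] have a limit
    by [complete_nested_limit]. *)
Definition convergent (z : cantor_borel) : Prop :=
  (forall k : nat, exists i : nat, z (pickle (i, k))) /\
  (forall q : (nat * nat) * (nat * nat), z (pickle q.1) -> z (pickle q.2) ->
    mdist (e q.1.1) (e q.2.1) <= 2 ^- q.1.2 + 2 ^- q.2.2).

Lemma measurable_bit (p : nat) : measurable [set z : cantor_borel | z p].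
Proof. exact: (measurable_power_bit p true). Qed.

Lemma measurable_convergent : measurable [set z | convergent z].
Proof.
apply: measurableI.
  apply: measurable_forall => k; apply: measurable_exists => i.
  exact: measurable_bit.
apply: measurable_forall => q.
apply: measurable_imply; first exact: measurable_bit.
apply: measurable_imply; first exact: measurable_bit.
exact: measurable_const.
Qed.

Lemma bits_convergent x : convergent (bits x).
Proof.
split=> [k|[[i k] [j n]]] /=.
  by have [i xi] := dense_e x k; exists i; rewrite bitsE.
rewrite !bitsE => xi xj; apply: le_trans (metric_triangle _ x _) _.
by rewrite (metric_sym x) lerD // ltW.
Qed.

Lemma exists_bits_retract : exists r : cantor_borel -> P,
  cancel bits r /\ forall U, open U -> measurable (r @^-1` U).
Proof.
have /choice[r rP] : forall z, exists l,
    (convergent z -> forall k i : nat, z (pickle (i, k)) -> mdist (e i) l <= 2 ^- k) /\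
    (~ convergent z -> l = e 0).
  move=> z; have [cz|ncz] := pselect (convergent z); last by exists (e 0).
  have [||l lP] := @complete_nested_limit
      (fun k => [set e i | i in [set i | z (pickle (i, k))]]).
  - by move=> k; have [i zi] := cz.1 k; exists (e i), i.
  - by move=> k n _ _ [i zi <-] [j zj <-]; exact: (cz.2 ((i, k), (j, n))).
  by exists l; split => // _ k i zi; apply: lP; exists i.
exists r; split => [x|U oU].
  apply: mdist_positivity; apply/eqP; rewrite eq_le mdist_ge0 andbT.
  apply: le_pow2V => n; rewrite add0r.
  have [i xi] := dense_e x n.+1.
  have := (rP (bits x)).1 (bits_convergent x) n.+1 i; rewrite bitsE => /(_ xi) ri.
  apply: le_trans (metric_triangle _ (e i) _) _.
  by rewrite metric_sym [leRHS]pow2V_split lerD // ltW.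
(* For convergent [z], [r z] is in [U] exactly when [z] selects a centre and radius whose closed
   ball lies in [U]; every other [z] is sent to [e 0]. *)
have -> : r @^-1` U =
    ([set z | convergent z] `&` [set z | exists q : nat * nat,
      (forall y, mdist (e q.1) y <= 2 ^- q.2 -> U y) /\ z (pickle q)]) `|`
    (~` [set z | convergent z] `&` [set _ | U (e 0)]).
  apply/seteqP; split => [z /= Uz|z [[/= cz [[i k] [kU zi]]]|[/= ncz]]].
  - have [cz|ncz] := pselect (convergent z); last first.
      by right; split => //; move: Uz; rewrite (rP z).2.
    left; split => //.
    have /nbhs_ballP[d /= d0 dU] : nbhs (r z) U by exact: open_nbhs_nbhs.
    have [k kd] : exists k, 2 ^- k < d / 2 by apply: pow2V_lt; rewrite divr_gt0.
    have [i zi] := cz.1 k; exists (i, k); split => //= y iy.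
    have ri := (rP z).1 cz k i zi.
    apply: dU; rewrite ballEmdist /=.
    apply: le_lt_trans (metric_triangle _ (e i) _) _.
    rewrite metric_sym (splitr d) ltrD //; exact: le_lt_trans kd.
  - exact/kU/((rP z).1 cz).
  - by rewrite (rP z).2.
apply: measurableU; apply: measurableI.
- exact: measurable_convergent.
- apply: measurable_exists => q; apply: measurableI; first exact: measurable_const.
  exact: measurable_bit.
- by apply: measurableC; exact: measurable_convergent.
- exact: measurable_const.
Qed.

End metric_retract.

Lemma standard_borel_retract (R : realType) d (X : measurableType d) :
  standard_borel R X ->
  exists (phi : X -> cantor_borel) (psi : cantor_borel -> X),
    [/\ measurable_fun setT phi, measurable_fun setT psi & cancel phi psi].
Proof.
move=> [P [h [[complete [D cD dD]] [h' hK h'K] hB]]].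
have [e eP] : exists e : nat -> P, D `<=` range e.
  have /countable_injP[f finj] := cD.
  (* The injection [f] of [D] into the naturals is inverted; numbers outside its image get the
     default [h point]. *)
  have /choice[e He] : forall n, exists p : P, forall q, D q -> f q = n -> p = q.
    move=> n; have [[q [Dq fq]]|nq] := pselect (exists q, D q /\ f q = n).
      exists q => q' Dq' fq'; apply: finj; rewrite ?fq ?fq' //; exact/mem_set.
    by exists (h point) => q Dq fq; case: nq; exists q.
  by exists e => q Dq; exists (f q) => //; exact: He.
have dense_e x k : exists i, (mdist (e i) x < 2 ^- k :> R)%R.
  have [] := dD (ball x (2 ^- k : R)%R)^°.
  - by exists x; apply: nbhsx_ballx; exact: pow2V_gt0.
  - exact: open_interior.
  move=> q [/interior_subset xq /eP[i _ iq]]; exists i.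
  by move: xq; rewrite iq ballEmdist /= metric_sym.
have [r [rK mr]] := exists_bits_retract complete dense_e.
exists (bits e \o h), (h' \o r); split.
- apply: measurable_fun_power => n.
  apply: (@measurable_fun_bool _ _ _ _ true); rewrite setTI.
  set p : nat * nat := odflt (0, 0) (unpickle n).
  have oB : open (ball (e p.1) (2 ^- p.2 : R)%R).
    rewrite openE => x; rewrite ballEmdist /= => xp.
    apply/nbhs_ballP; exists (2 ^- p.2 - mdist (e p.1) x)%R => /=.
      by rewrite subr_gt0.
    move=> y; rewrite ballEmdist /= => xy.
    apply: le_lt_trans (metric_triangle _ x _) _.
    by rewrite addrC -ltrBrDr.
  have /hB : <<s open >> (ball (e p.1) (2 ^- p.2 : R)%R).
    exact: sub_sigma_algebra.
  by rewrite ballEmdist.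
- move=> _ A mA; rewrite setTI.
  have : <<s open >> (h' @^-1` A).
    apply/hB; move: mA; congr measurable.
    by apply/seteqP; split => x /=; rewrite hK.
  suff : <<s open >> `<=` [set B | measurable (r @^-1` B)] by exact.
  apply: smallest_sub; last exact: mr.
  split=> /=.
  + by rewrite preimage_set0; exact: measurable0.
  + by move=> B mB; rewrite setTD preimage_setC; exact: measurableC.
  + by move=> B mB; rewrite preimage_bigcup; exact: bigcupT_measurable.
- by move=> x /=; rewrite rK hK.
Qed.

(** * Universality *)

Lemma quasi_order_generators (R : realType) d (X : measurableType d)
    (Q : X -> X -> Prop) :
  countable_borel_quasi_order R Q ->
  exists2 f : nat -> X -> X, forall n, measurable_fun [set: X] (f n) &
    forall x y, Q y x <-> exists n, y = f n x.
Proof.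
move=> [sX Qrefl Qtrans mQ cQ].
have [phi [psi [mphi mpsi phiK]]] := standard_borel_retract sX.
(* The first condition confines the second coordinate to the image of [phi], on which [psi] is
   injective; this keeps the sections countable. *)
pose P : set (cantor_borel * cantor_borel) :=
  [set p | phi (psi p.2) = p.2] `&` [set p | Q (psi p.2) (psi p.1)].
have mP : measurable P.
  apply: measurableI.
    apply: (@measurable_cantor_eq _ _ (phi \o psi \o snd) snd).
      by do 2 apply: measurableT_comp => //.
    exact: measurable_snd.
  pose F (p : cantor_borel * cantor_borel) := (psi p.2, psi p.1).
  have mF : measurable_fun setT F.
    by apply: measurable_fun_pair; exact: measurableT_comp.
  by have := mF measurableT _ mQ; rewrite setTI.
have cP x : countable [set y | P (x, y)].
  apply: sub_countable (cQ (psi x)).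
  apply: (card_le_trans _ (card_image_le phi _)).
  by apply: subset_card_le => y [/= E Qy]; exists (psi y).
have [g mg gP] := lusin_novikov mP cP.
pose G n x := psi (g n (phi x)).
have mG n : measurable_fun setT (G n).
  by apply: measurableT_comp => //; exact: measurableT_comp.
(* Where [G n x] is not below [x], the value [x] is admissible by reflexivity. *)
exists (fun n x => if `[< Q (G n x) x >] then G n x else x).
  move=> n; apply: measurable_fun_ifT => //.
  apply: (@measurable_fun_bool _ _ _ _ true); rewrite setTI.
  have mF : measurable_fun setT (fun x => (G n x, x)).
    by apply: measurable_fun_pair.
  have := mF measurableT _ mQ; rewrite setTI; congr measurable.
  by apply/seteqP; split => x /= /asboolP.
move=> x y; split => [Qyx|[n ->]]; last by case: asboolP.
have [|n En] := gP (phi x) (phi y); first by split => /=; rewrite !phiK.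
exists n; have -> : G n x = y by rewrite /G En phiK.
by case: asboolP.
Qed.

(** The generators make the free monoid act on [X], and a point is coded by [phi] along its orbit;
    shifting the code by [m] gives the code of [act m x]. *)
Lemma preceq_omega_universal (R : realType) d (X : measurableType d)
    (Q : X -> X -> Prop) :
  countable_borel_quasi_order R Q -> borel_reducible Q preceq_omega.
Proof.
move=> cbQ; have [sX Qrefl Qtrans _ _] := cbQ.
have [phi [psi [mphi mpsi phiK]]] := standard_borel_retract sX.
have [f mf fP] := quasi_order_generators cbQ.
pose act (w : M_omega) (x : X) : X := foldr f x w.
have mact w : measurable_fun setT (act w).
  by elim: w => [|n w IH]; [exact: measurable_id|exact: (measurableT_comp (mf n))].
have actQ w x : Q (act w x) x.
  elim: w => [|n w IH]; first exact: Qrefl.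
  by apply: Qtrans IH; apply/fP; exists n.
pose F x : power M_omega cantor_borel := fun w => phi (act w x).
have FE m x : mshift m (F x) = F (act m x).
  apply/funext => s; rewrite /mshift /F /act.
  by rewrite -[(s * m)%g]/(s ++ m) foldr_cat.
exists F.
  by apply: measurable_fun_power => w; exact: measurableT_comp.
move=> x y; split.
  by move=> /fP[n ->]; exists ([:: n] : M_omega); rewrite FE.
(* Evaluation at the identity of the monoid recovers the points from their codes. *)
move=> [m]; rewrite FE => /(congr1 (fun G => psi (G 1%g))).
by rewrite /F /= !phiK => ->; exact: actQ.
Qed.

Lemma countable_borel_preceq_M2_2 (R : realType) :
  countable_borel_quasi_order R preceq_M2_2.
Proof.
split.
- exact: standard_borel_power_bool.
- exact: mshift_le_refl.
- exact: mshift_le_trans.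
- apply: (@measurable_exists _ _ M_two) => m.
  suff : measurable [set p : power M_two bool * power M_two bool |
      forall s : M_two, p.1 s = p.2 (s * m)%g].
    by congr measurable; apply/seteqP; split => p /= E; [apply/funext|rewrite E].
  apply: measurable_forall => s.
  apply: (@measurable_bool_eq _ (power M_two bool * power M_two bool)%type
    (fun p => p.1 s) (fun p => p.2 (s * m)%g)).
    exact: (measurableT_comp (@measurable_power_proj M_two _ bool s)).
  exact: (measurableT_comp (@measurable_power_proj M_two _ bool (s * m)%g)).
- move=> g; apply: sub_countable (countableP [set: M_two]).
  apply: (card_le_trans _ (card_image_le (fun m : M_two => mshift m g) _)).
  by apply: subset_card_le => f [m ->]; exists m.
Qed.

Theorem theorem2p9 (R : realType) :
  borel_reducible preceq_omega preceq_M2_2 /\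
  universal_countable_borel_quasi_order R preceq_M2_2.
Proof.
split; first exact: preceq_omega_reducible.
split; first exact: countable_borel_preceq_M2_2.
move=> d Y Q /preceq_omega_universal Qo.
exact: borel_reducible_trans Qo preceq_omega_reducible.
Qed.
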